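(* Let $R$ be a ring, $S$ an $m$-system of $R$, $M$ an $S$-multiplication right $R$-module, and $P,P_1,\dots,P_n$ submodules of $M$ such that at least $n-2$ of the submodules $P_1,\dots,P_n$ are $S$-prime. If $P\subseteq P_1\cup P_2\cup\cdots\cup P_n$, then there exist $s\in S$ and $i\in\{1,\dots,n\}$ such that $P\langle s\rangle\subseteq P_i$.
   Context: Rings are associative with unity and modules are right (unital) modules. For $s\in R$, $\langle s\rangle$ denotes the two-sided ideal generated by $s$. A nonempty subset $S\subseteq R$ is an $m$-system if for all $a,b\in S$ there is $r\in R$ with $arb\in S$. $(P:_R M)=\{r\in R: Mr\subseteq P\}$. For a submodule $N$ of $M$ and a two-sided ideal $I$, $NI$ is the submodule generated by the products $ni$ ($n\in N$, $i\in I$). $M$ is an $S$-multiplication module if for each submodule $N$ of $M$ there exist $s\in S$ and a two-sided ideal $I$ of $R$ (possibly $I=R$) such that $N\langle s\rangle\subseteq MI\subseteq N$. A submodule $Q$ of $M$ is $S$-prime if $(Q:_R M)\cap S=\emptyset$ and there is $s\in S$ such that for all $a\in R$ and $m\in M$, $mRa\subseteq Q$ implies $a\langle s\rangle\subseteq (Q:_R M)$ or $m\langle s\rangle\subseteq Q$. Here $n\ge 1$ is an integer. *)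

(* Defs.v *)
From mathcomp Require Import all_boot all_algebra.
From mathcomp Require Import boolp classical_sets.

Set Implicit Arguments.
Unset Strict Implicit.
Unset Printing Implicit Defensive.

Local Open Scope ring_scope.
Local Open Scope classical_set_scope.

(* MathComp only has left modules: a right R-module is a left module over the
   converse ring R^c, so that x ·r (a * b) = (x ·r a) ·r b. *)
Definition ract (R : pzRingType) (M : lmodType R^c) (x : M) (r : R) : M :=
  (r : R^c) *: x.

Notation "x ·r a" := (ract x a) (at level 40, left associativity) : ring_scope.

Definition two_sided_ideal (R : pzRingType) (I : set R) : Prop :=
  [/\ GRing.zmod_closed [in I],
      forall r x, I x -> I (r * x)
    & forall r x, I x -> I (x * r)].

Definition gen_ideal (R : pzRingType) (s : R) : set R :=
  smallest (@two_sided_ideal R) [set s].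

Definition m_system (R : pzRingType) (S : set R) : Prop :=
  S !=set0 /\ forall a b, S a -> S b -> exists r : R, S (a * r * b).

Definition submodule (R : pzRingType) (M : lmodType R^c) (N : set M) : Prop :=
  GRing.submod_closed [in N].

Definition mulmod (R : pzRingType) (M : lmodType R^c)
    (N : set M) (I : set R) : set M :=
  smallest (@submodule R M) [set x ·r i | x in N & i in I].

Definition colon (R : pzRingType) (M : lmodType R^c) (P : set M) : set R :=
  [set r | forall x : M, P (x ·r r)].

Definition S_multiplication (R : pzRingType) (S : set R)
    (M : lmodType R^c) : Prop :=
  forall N : set M, submodule N ->
    exists s (I : set R),
      [/\ S s, two_sided_ideal I,
          mulmod N (gen_ideal s) `<=` mulmod [set: M] I
        & mulmod [set: M] I `<=` N].

Definition S_prime (R : pzRingType) (S : set R) (M : lmodType R^c)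
    (Q : set M) : Prop :=
  [/\ submodule Q,
      colon Q `&` S = set0
    & exists2 s, S s & forall (a : R) (m : M),
        [set m ·r r ·r a | r in [set: R]] `<=` Q ->
        [set a * x | x in gen_ideal s] `<=` colon Q \/
        [set m ·r x | x in gen_ideal s] `<=` Q].

(* Main.v *)
Require Import Defs.
From mathcomp Require Import all_boot all_algebra.
From mathcomp Require Import boolp classical_sets.

(** The theorem reduces to ordinary prime avoidance, with no loss, by
    enlarging the S-prime members of the cover.

    Let [Q] be S-prime, witnessed by [s].  Its saturation
    [Q' = {m | m<s> `<=` Q}] contains [Q], satisfies [Q'<s> `<=` Q], and is
    prime in the strict sense: [mRa `<=` Q'] forces [Ma `<=` Q'] or
    [m \in Q'] ([saturation_prime], [saturation_disjoint]).  Replacing every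
    S-prime [P_i] by its saturation keeps the cover, and an inclusion of [P]
    in a saturation gives [P<s> `<=` P_i].  It is therefore enough to find a
    member of the enlarged cover that contains [P] itself
    ([prime_avoidance]).

    For this one may assume by induction that no member of the cover is
    superfluous.  Translating by a point of [P] lying only in the member
    [N_k] shows that the part of [P] common to all the other members lies in
    [N_k] ([efficient_cover_meet]).  If no member is prime there are at most
    two of them; if there are two, each contains the part of [P] in the
    other, which is then superfluous.
    Otherwise take [N_k] prime.  No other [N_i] lies in [N_k], so, [M] being
    an S-multiplication module, [(N_i : M)] does not lie in [(N_k : M)]
    ([sub_of_sub_colon]).  If [P] had a point outside [N_k], primeness would
    allow multiplying that point by an element of each [(N_i : M)] in turn
    while staying outside [N_k] ([prime_avoids_meet]); the result lies in [P]
    and in every [N_i] with [i != k] but not in [N_k], a contradiction. *)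

Set Implicit Arguments.
Unset Strict Implicit.
Unset Printing Implicit Defensive.

Import GRing.Theory.

Local Open Scope ring_scope.
Local Open Scope classical_set_scope.

(** * Ideals and submodules *)

Section Submodules.
Variables (R : pzRingType) (M : lmodType R^c).
Implicit Types (N P Q : set M) (I : set R) (m : M) (a b r s : R).

Lemma ractA m a b : m ·r (a * b) = m ·r a ·r b.
Proof. by rewrite /ract scalerA. Qed.

Lemma ract1 m : m ·r 1 = m.
Proof. exact: scale1r. Qed.

Lemma ractDl (x y : M) a : (x + y) ·r a = x ·r a + y ·r a.
Proof. exact: scalerDr. Qed.

Lemma ract0l a : (0 : M) ·r a = 0.
Proof. exact: scaler0. Qed.

Lemma submoduleP N :
  submodule N <->
  [/\ N 0, forall x y, N x -> N y -> N (x + y) & forall x a, N x -> N (x ·r a)].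
Proof.
split=> [[N0 Nlin]|[N0 ND NZ]].
- have N0' : N 0 by rewrite inE in N0.
  have Nl a x y : N x -> N y -> N (x ·r a + y).
    by move=> Nx Ny; move: (Nlin (a : R^c) x y); rewrite !inE; apply.
  split=> // [x y Nx Ny|x a Nx]; first by rewrite -(ract1 x); apply: Nl.
  by rewrite -[_ ·r _]addr0; apply: Nl.
- split; first by rewrite inE.
  by move=> a x y; rewrite !inE => Nx Ny; apply: ND => //; apply: NZ.
Qed.

Lemma submoduleB N x y : submodule N -> N x -> N y -> N (x - y).
Proof.
move=> /submoduleP[_ ND NZ] Nx Ny; apply: ND => //.
by rewrite -scaleN1r; apply: (NZ _ (- 1 : R)).
Qed.

Lemma mem_gen_ideal s : gen_ideal s s.
Proof. by move=> I [_ sI]; apply: sI. Qed.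

Lemma gen_ideal_mull s r x : gen_ideal s x -> gen_ideal s (r * x).
Proof. by move=> sx I sI; have [[_ + _] _] := sI; apply; exact: sx. Qed.

Lemma mulmod_subP N I Q : submodule Q ->
  mulmod N I `<=` Q <-> (forall m a, N m -> I a -> Q (m ·r a)).
Proof.
move=> sQ; split=> [NIQ m a Nm Ia|NIQ].
  by apply: NIQ => L [_]; apply; exists m => //; exists a.
by apply: smallest_sub => // _ [m Nm [a Ia <-]]; exact: NIQ.
Qed.

Lemma mulmod_subl N P I : N `<=` P -> mulmod N I `<=` mulmod P I.
Proof.
move=> NP x NIx L [sL PIL]; apply: NIx; split=> // _ [m /NP Pm [a Ia <-]].
by apply: PIL; exists m => //; exists a.
Qed.

Lemma sub_mulmod_gen N s : submodule N -> mulmod N (gen_ideal s) `<=` N.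
Proof. by move=> sN; apply/mulmod_subP => // m a Nm _; case/submoduleP: sN; auto. Qed.

(** * Prime submodules *)

(** [Q] may be the whole module here: properness is carried separately, by
    the stronger condition that [(Q : M)] is disjoint from [S]. *)
Definition prime_submodule Q : Prop :=
  submodule Q /\
  forall a m, (forall r, Q (m ·r r ·r a)) -> colon Q a \/ Q m.

(** Multiplying a point [m] outside [Q] by a scalar [a] outside [(Q : M)]
    may land in [Q], but [m ·r r ·r a] stays outside for some [r]; iterating
    this once per member of the family gives the point. *)
Lemma prime_avoids_meet (T : eqType) (N : T -> set M) Q P (l : seq T) :
  prime_submodule Q -> submodule P ->
  (forall i, submodule (N i)) ->
  (forall i, i \in l -> ~ colon (N i) `<=` colon Q) ->
  ~ P `<=` Q ->
  exists p, [/\ P p, ~ Q p & forall i, i \in l -> N i p].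
Proof.
move=> [_ Qpr] /submoduleP[_ _ PZ] sN + /existsNP[p0 /not_implyP[Pp0 Qp0]].
elim: l => [_|j l IHl Nl]; first by exists p0.
have [i li|p [Pp Qp Np]] := IHl; first by apply: Nl; rewrite inE li orbT.
have /existsNP[a /not_implyP[Nja Qa]] : ~ colon (N j) `<=` colon Q.
  by apply: Nl; rewrite mem_head.
have /existsNP[r Qra] : ~ (forall r, Q (p ·r r ·r a)).
  by move=> /Qpr[].
exists (p ·r r ·r a); split=> //; first by apply/PZ/PZ.
move=> i; rewrite inE => /predU1P[->|/Np Nip]; first exact: Nja.
by have /submoduleP[_ _ NZ] := sN i; apply/NZ/NZ.
Qed.

(** If [y] lies in [P] and in all the other members, then none of those
    contains [y + x], where [x] is a point of [P] that only [N k] covers; hence [N k]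
    contains both [y + x] and [x], and so their difference. *)
Lemma efficient_cover_meet (T : finType) (N : T -> set M) P (D : {set T}) k :
  submodule P -> (forall i, submodule (N i)) ->
  P `<=` \bigcup_(i in [set` D]) N i ->
  ~ P `<=` \bigcup_(i in [set` D :\ k]) N i ->
  forall y, P y -> (forall i, i \in D :\ k -> N i y) -> N k y.
Proof.
move=> sP sN PD /existsNP[x /not_implyP[Px Dkx]] y Py Ny.
have only_k z : P z -> (forall i, i \in D -> i != k -> ~ N i z) -> N k z.
  move=> /PD[i /= Di Niz] nN.
  by have [<-//|/(nN i Di)] := eqVneq i k; last by case/(_ Niz).
have xk i : i \in D -> i != k -> ~ N i x.
  by move=> Di ik Nix; apply: Dkx; exists i => //=; rewrite !inE ik.
have Nkx : N k x by apply: only_k.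
have Nkyx : N k (y + x).
  apply: only_k => [|i Di ik Niyx]; first by have /submoduleP[_ + _] := sP; apply.
  apply: (xk i Di ik); have -> : x = (y + x) - y by rewrite addrC addKr.
  by apply: submoduleB => //; apply: Ny; rewrite !inE ik.
by rewrite -(addrK x y); exact: submoduleB.
Qed.

(** * Saturation of S-prime submodules *)

(** The residual [(Q : <s>)], the largest [N] with [N<s> `<=` Q]. *)
Definition saturation s Q : set M :=
  [set m | forall x, gen_ideal s x -> Q (m ·r x)].

Lemma saturation_submodule s Q : submodule Q -> submodule (saturation s Q).
Proof.
move=> /submoduleP[Q0 QD QZ]; apply/submoduleP; split.
- by move=> x _; rewrite ract0l.
- by move=> x y Qx Qy z sz; rewrite ractDl; apply: QD; [exact: Qx|exact: Qy].
- by move=> m a Qm x sx; rewrite -ractA; apply: Qm; exact: gen_ideal_mull.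
Qed.

Lemma sub_saturation s Q : submodule Q -> Q `<=` saturation s Q.
Proof. by move=> /submoduleP[_ _ QZ] m Qm x _; exact: QZ. Qed.

Lemma mulmod_saturation s Q :
  submodule Q -> mulmod (saturation s Q) (gen_ideal s) `<=` Q.
Proof. by move=> sQ; apply/mulmod_subP => // m x + sx; apply. Qed.

Variable S : set R.
Hypothesis S_msystem : m_system S.

Lemma saturation_disjoint s Q :
  colon Q `&` S = set0 -> S s -> colon (saturation s Q) `&` S = set0.
Proof.
move=> QS Ss; rewrite -subset0 => t [Qt St].
have [r Strs] := S_msystem.2 t s St Ss.
suff : (colon Q `&` S) (t * r * s) by rewrite QS.
split=> // m; rewrite -mulrA ractA.
by apply: Qt; apply: gen_ideal_mull; exact: mem_gen_ideal.
Qed.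

(** Suppose [mRa `<=` Q'] and [m] is not in [Q'].  S-primeness applied to
    [mR(ax) `<=` Q] for [x] in [<s>] gives [Ma<s><s> `<=` Q].  As
    [z = s * r * s] lies in [S] for some [r], this contains [(Ma)Rz `<=` Q];
    now S-primeness applied to [z] gives [Ma<s> `<=` Q], that is
    [Ma `<=` Q'].  Its other alternative [z<s> `<=` (Q : M)] is excluded,
    because [z * r' * s] lies in [S] for some [r']. *)
Lemma saturation_prime s Q :
  submodule Q -> colon Q `&` S = set0 -> S s ->
  (forall a m, [set m ·r r ·r a | r in [set: R]] `<=` Q ->
     [set a * x | x in gen_ideal s] `<=` colon Q \/
     [set m ·r x | x in gen_ideal s] `<=` Q) ->
  prime_submodule (saturation s Q).
Proof.
move=> sQ QS Ss Qpr; split; first exact: saturation_submodule.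
move=> a m Qma; have [Qm|nQm] := pselect (saturation s Q m); [by right|left].
have Qass x y m' : gen_ideal s x -> gen_ideal s y -> Q (m' ·r a ·r x ·r y).
  move=> sx sy; rewrite -!ractA mulrA.
  have [_ [r _ <-]||] := Qpr (a * x) m; first by rewrite ractA; exact: Qma.
    by apply; exists y.
  by move=> Qm; case: nQm => z sz; apply: Qm; exists z.
have [r Ssrs] := S_msystem.2 s s Ss Ss.
have [r' Sz] := S_msystem.2 _ s Ssrs Ss.
move=> m' x sx.
have [_ [b _ <-]|Qz|] := Qpr (s * r * s) (m' ·r a).
- have -> : m' ·r a ·r b ·r (s * r * s) = m' ·r a ·r (b * s) ·r (r * s).
    by rewrite -!ractA !mulrA.
  by apply: Qass; apply: gen_ideal_mull; exact: mem_gen_ideal.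
- have : (colon Q `&` S) (s * r * s * r' * s); last by rewrite QS.
  split=> //; apply: Qz; exists (r' * s); last by rewrite mulrA.
  by apply: gen_ideal_mull; exact: mem_gen_ideal.
- by apply; exists x.
Qed.

(** * Prime avoidance in S-multiplication modules *)

Hypothesis M_multiplication : S_multiplication S M.

(** In a multiplication module [N = M(N : M)], so [(N : M)] determines [N].
    Here this holds only up to a factor [<s>] with [s] in [S], which
    primeness of [Q] cancels. *)
Lemma sub_of_sub_colon N Q :
  prime_submodule Q -> colon Q `&` S = set0 -> submodule N ->
  colon N `<=` colon Q -> N `<=` Q.
Proof.
move=> [sQ Qpr] QS sN NQ m Nm.
have [s [I [Ss _ NsMI MIN]]] := M_multiplication sN.
have MIQ : mulmod [set: M] I `<=` Q.
  apply/mulmod_subP => // m' a _ Ia; apply: NQ => x.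
  by move/mulmod_subP: MIN; apply.
have /(mulmod_subP _ _ sQ) Ns := subset_trans NsMI MIQ.
have [r|Qs|//] := Qpr s m.
  by rewrite -ractA; apply: Ns => //; apply: gen_ideal_mull; exact: mem_gen_ideal.
by have : (colon Q `&` S) s by []; rewrite QS.
Qed.

(** Induction on the number of members reduces to a cover none of whose
    members is superfluous.  [A] indexes primes, so that a cover disjoint
    from [A] has at most two members, while a prime member of the cover must
    contain [P]. *)
Lemma prime_avoidance (T : finType) (A D : {set T}) (N : T -> set M) P :
  submodule P -> (forall i, submodule (N i)) ->
  (forall i, i \in A -> prime_submodule (N i) /\ colon (N i) `&` S = set0) ->
  (#|D :\: A| <= 2)%N ->
  P `<=` \bigcup_(i in [set` D]) N i ->
  exists i, P `<=` N i.
Proof.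
move=> sP sN Npr.
have [d] := ubnP #|D|; elim: d => // d IHd in D *; rewrite ltnS => Dd DA PD.
have [[k Dk PDk]|eff] := pselect (exists2 k,
    k \in D & P `<=` \bigcup_(i in [set` D :\ k]) N i).
  apply: (IHd (D :\ k)) => //; first by rewrite [#|D|](cardsD1 k) Dk in Dd.
  by apply: leq_trans DA; apply/subset_leq_card/finset.setSD/subD1set.
have meet k : k \in D -> forall y, P y ->
    (forall i, i \in D :\ k -> N i y) -> N k y.
  by move=> Dk; apply: (efficient_cover_meet sP sN PD) => PDk; apply: eff; exists k.
have superfluous i k : i \in D -> k \in D -> i != k -> P `&` N i `<=` N k -> False.
  move=> Di Dk ik Nik; apply: eff; exists i => // x Px.
  have [j /= Dj Njx] := PD x Px; have [ji|ji] := eqVneq j i.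
    exists k => /=; first by rewrite !inE eq_sym ik.
    by apply: Nik; split=> //; rewrite -ji.
  by exists j => //=; rewrite !inE ji.
(* The cover contains no index of A: it has one member or two. *)
have [AD0|[k]] := set_0Vmem (D :&: A).
  have P0 : P 0 by case/submoduleP: sP.
  have [k /= Dk _] := PD 0 P0; exists k.
  have [Dk0|[i]] := set_0Vmem (D :\ k).
    by move=> y Py; apply: meet => // j; rewrite Dk0 inE.
  rewrite !inE => /andP[ik Di]; exfalso.
  apply: (superfluous i k) => // y [Py Niy]; apply: meet => // j.
  have Dki : D :\ k = [set i]%SET.
    apply/esym/eqP; rewrite eqEcard finset.sub1set !inE ik Di cards1 /=.
    by rewrite -(leq_add2l (k \in D)) -cardsD1 Dk -(cardsID A D) AD0 cards0.
  by rewrite Dki inE => /eqP->.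
(* N k is prime: a point of P outside N k could be moved into all the other
   members while remaining outside N k. *)
rewrite inE => /andP[Dk Ak]; have [Nkpr NkS] := Npr k Ak.
exists k; apply: contrapT => PNk.
have [|p [Pp Nkp Np]] :=
    prime_avoids_meet (N := N) (l := enum (D :\ k)) Nkpr sP sN _ PNk.
  move=> i; rewrite mem_enum !inE => /andP[ik Di] Nik.
  apply: (superfluous i k) => // y [_].
  exact: sub_of_sub_colon.
by apply/Nkp/meet => // i Di; apply: Np; rewrite mem_enum.
Qed.

End Submodules.

Theorem theorem2p13 (R : pzRingType) (S : set R) (hS : m_system S)
    (M : lmodType R^c) (hM : S_multiplication S M)
    (n : nat) (hn : (1 <= n)%N)
    (P : set M) (hP : submodule P)
    (Pi : 'I_n -> set M) (hPi : forall i, submodule (Pi i))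
    (hprime : exists A : {set 'I_n},
        (n - 2 <= #|A|)%N /\ forall i, i \in A -> S_prime S (Pi i))
    (hcover : P `<=` \bigcup_(i in [set: 'I_n]) Pi i) :
  exists s (i : 'I_n), S s /\ mulmod P (gen_ideal s) `<=` Pi i.
Proof.
have [A [An Apr]] := hprime; have [[s0 Ss0] _] := hS.
have enlarge i : exists N : set M, [/\ submodule N, Pi i `<=` N,
    i \in A -> prime_submodule N /\ colon N `&` S = set0 &
    exists2 s, S s & mulmod N (gen_ideal s) `<=` Pi i].
  have [Ai|Ai] := boolP (i \in A); last first.
    by exists (Pi i); split=> //; exists s0 => //; exact: sub_mulmod_gen.
  have [sQ QS [s Ss Qpr]] := Apr i Ai.
  exists (saturation s (Pi i)); split.
  - exact: saturation_submodule.
  - exact: sub_saturation.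
  - by split; [exact: (saturation_prime hS)|exact: (saturation_disjoint hS)].
  - by exists s => //; exact: mulmod_saturation.
have [N HN] := choice enlarge.
have [||||i PNi] := @prime_avoidance R M S hM _ A [set: 'I_n]%SET N P hP.
- by move=> i; case: (HN i).
- by move=> i; case: (HN i).
- by rewrite finset.setTD cardsCs finset.setCK card_ord leq_subCl.
- move=> x /hcover[i _ Pix]; exists i => /=; first by rewrite inE.
  by case: (HN i) => _ + _ _; apply.
have [_ _ _ [s Ss NsP]] := HN i.
by exists s, i; split=> //; exact: subset_trans (mulmod_subl PNi) NsP.
Qed.
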